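(* Let $A$ be a real symmetric $n\times n$ matrix and $b\in\mathbb{R}^n$ with $\|b\|_2=1$, and let $1\le k\le K$, where $K$ is the number of steps at which the Lanczos algorithm for $(A,b)$ terminates. Let $r(x)=M(x)/N(x)$ be a rational function, where $N$ is a polynomial with leading coefficient one that is nonzero at every eigenvalue of $A$, and $M$ is a polynomial sharing no common factors with $N$. Choose a polynomial $R(x)$ so that $H=N(A)R(A)$ is positive definite. Then the Lanczos-OR iterate $\mathsf{lan\text{-}OR}_k(r,R)$ is the $H$-norm optimal approximation to $r(A)b$ from $\mathcal{K}_k$; i.e., $$\|r(A)b-\mathsf{lan\text{-}OR}_k(r,R)\|_{H}=\min_{x\in\mathcal{K}_k}\|r(A)b-x\|_{H}.$$
   Context: Krylov subspace: $\mathcal{K}_k=\operatorname{span}\{b,Ab,\ldots,A^{k-1}b\}=\{p(A)b:\deg p<k\}$. Polynomials may have complex coefficients, in which case the span is over $\mathbb{C}$. Lanczos quantities (exact arithmetic): $q_0=b$, $q_{-1}=0$, $\beta_{-1}=0$, and for $j=0,1,\ldots$: $\alpha_j=q_j^{\mathsf T}Aq_j$, $\tilde q_{j+1}=Aq_j-\beta_{j-1}q_{j-1}-\alpha_jq_j$, $\beta_j=\|\tilde q_{j+1}\|_2$, $q_{j+1}=\tilde q_{j+1}/\beta_j$ if $\beta_j\neq 0$; the algorithm terminates at the first $K\le n$ with $\beta_{K-1}=0$. Then $\widehat Q=[q_0,\ldots,q_{K-1}]$ has orthonormal columns, the first $j$ of which form a basis of $\mathcal{K}_j$ for each $j\le K$,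 and $A\widehat Q=\widehat Q\widehat T$, where $\widehat T$ is the $K\times K$ symmetric tridiagonal matrix with diagonal $(\alpha_0,\ldots,\alpha_{K-1})$ and off-diagonal $(\beta_0,\ldots,\beta_{K-2})$. Let $Q=[q_0,\ldots,q_{k-1}]$. For a matrix $B$, $[B]_{:k,:k}$ denotes its leading $k\times k$ submatrix, and $e_0=(1,0,\ldots,0)^{\mathsf T}\in\mathbb{R}^k$. Lanczos-OR iterate: with $\tilde M(x)=M(x)R(x)$ and $\tilde N(x)=N(x)R(x)$, $$\mathsf{lan\text{-}OR}_k(r,R):=Q\,\big([\tilde N(\widehat T)]_{:k,:k}\big)^{-1}[\tilde M(\widehat T)]_{:k,:k}\,e_0.$$ For positive definite $H$, $\|x\|_H=\sqrt{x^{*}Hx}$. *)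

(* Defs.v *)
From mathcomp Require Import all_boot all_order all_algebra.
From mathcomp Require Import complex.
Set Implicit Arguments.
Unset Strict Implicit.
Unset Printing Implicit Defensive.
Import Order.TTheory GRing.Theory Num.Theory.
Local Open Scope ring_scope.
Local Open Scope sesquilinear_scope.

Section Lanczos.
Variables (R : rcfType) (n : nat) (A : 'M[R]_n) (b : 'cV[R]_n).

Definition norm2 (v : 'cV[R]_n) : R := Num.sqrt ((v^T *m v) 0 0).

Definition rayleigh (q : 'cV[R]_n) : R := (q^T *m A *m q) 0 0.

(* The state at step j is (q_(j-1), beta_(j-1), q_j).  After the first zero
   beta the recursion goes on with zero vectors, because 0^-1 = 0; those values
   are never used, see [lanczos_terminates]. *)
Fixpoint lanczos_state (j : nat) : 'cV[R]_n * R * 'cV[R]_n :=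
  if j is i.+1 then
    let: (q', beta', q) := lanczos_state i in
    let w := A *m q - beta' *: q' - rayleigh q *: q in
    (q, norm2 w, (norm2 w)^-1 *: w)
  else (0, 0, b).

Definition lanczos_q (j : nat) : 'cV[R]_n := (lanczos_state j).2.
Definition lanczos_alpha (j : nat) : R := rayleigh (lanczos_q j).
Definition lanczos_beta (j : nat) : R := (lanczos_state j.+1).1.2.

Definition lanczos_terminates (K : nat) : Prop :=
  [/\ (0 < K <= n)%N, lanczos_beta K.-1 = 0
    & forall j : nat, (j.+1 < K)%N -> lanczos_beta j != 0].

Definition lanczos_Q (m : nat) : 'M[R]_(n, m) :=
  \matrix_(i < n, j < m) lanczos_q j i 0.

Definition lanczos_T (K : nat) : 'M[R]_K :=
  \matrix_(i < K, j < K)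
    if i == j :> nat then lanczos_alpha i
    else if i.+1 == j :> nat then lanczos_beta i
    else if j.+1 == i :> nat then lanczos_beta j
    else 0.

End Lanczos.

Definition krylov (F : fieldType) (n : nat) (A : 'M[F]_n) (b : 'cV[F]_n)
    (k : nat) : {vspace 'cV[F]_n} :=
  <<[seq A ^+ i *m b | i <- iota 0 k]>>%VS.

Definition leading (F : Type) (K k : nat) (hkK : (k <= K)%N)
    (B : 'M[F]_K) : 'M[F]_k :=
  mxsub (widen_ord hkK) (widen_ord hkK) B.

(* r(A) for r = M / N; meaningful when N(A) is invertible. *)
Definition ratmx (F : fieldType) (n : nat) (M N : {poly F})
    (A : 'M[F]_n.+1) : 'M[F]_n.+1 :=
  horner_mx A M *m invmx (horner_mx A N).

(* Q holds the first k Lanczos vectors, T is the full tridiagonal matrix; both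
   are arguments so that they can be taken over R or over R[i]. *)
Definition lan_OR (F : fieldType) (n K k : nat) (hkK : (k <= K.+1)%N)
    (Q : 'M[F]_(n, k)) (T : 'M[F]_K.+1) (M N P : {poly F}) : 'cV[F]_n :=
  Q *m invmx (leading hkK (horner_mx T (N * P)))
    *m leading hkK (horner_mx T (M * P))
    *m (\col_(i < k) (i == 0 :> nat)%:R).

Definition posdef (R : rcfType) (n : nat) (H : 'M[R]_n) : Prop :=
  H^T = H /\ forall x : 'cV[R]_n, x != 0 -> 0 < (x^T *m H *m x) 0 0.

(* On R[i], 0 < z means that z is real and positive. *)
Definition posdefC (C : numClosedFieldType) (n : nat) (H : 'M[C]_n) : Prop :=
  H^t* = H /\ forall x : 'cV[C]_n, x != 0 -> 0 < (x^t* *m H *m x) 0 0.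

Definition mxnorm_of (R : rcfType) (n : nat) (H : 'M[R]_n)
    (x : 'cV[R]_n) : R := Num.sqrt ((x^T *m H *m x) 0 0).

Definition mxnorm_ofC (C : numClosedFieldType) (n : nat) (H : 'M[C]_n)
    (x : 'cV[C]_n) : C := sqrtC ((x^t* *m H *m x) 0 0).

Definition best_approx (F : numFieldType) (n : nat) (nrm : 'cV[F]_n -> F)
    (S : {vspace 'cV[F]_n}) (y x : 'cV[F]_n) : Prop :=
  x \in S /\ forall z : 'cV[F]_n, z \in S -> nrm (y - x) <= nrm (y - z).

Definition toC (R : rcfType) (m n : nat) (B : 'M[R]_(m, n)) : 'M[R[i]]_(m, n) :=
  map_mx (real_complex R) B.

(* Main.v *)
Require Import Defs.
From mathcomp Require Import all_boot all_order all_algebra.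
From mathcomp Require Import complex.
Set Implicit Arguments.
Unset Strict Implicit.
Import Order.TTheory GRing.Theory Num.Theory.
Local Open Scope ring_scope.
Local Open Scope sesquilinear_scope.

(** The iterate is a Galerkin projection.  The columns of the full Lanczos
    basis [Q^] are orthonormal and satisfy [A Q^ = Q^ T^], so every polynomial
    [p] gives [p(A) Q^ = Q^ p(T^)], and cutting down to the first [k] columns
    [Q] turns the leading block of [p(T^)] into the compression [Q* p(A) Q].
    Apply this twice.  For [p = N P] the block is [L = Q* H Q], which inherits
    definiteness, hence invertibility, from [H].  For [p = M P], since [b] is
    the first column of [Q] and [H r(A) = M(A) P(A)], the block applied to the
    first unit vector is [Q* H y], where [y = r(A) b].  So the iterate is
    [x = Q L^-1 Q* H y], whose error satisfies [Q* H (y - x) = 0]: it is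
    [H]-orthogonal to the range of [Q], and Pythagoras makes [x] optimal in
    that range ([lan_OR_minimizes]).

    It remains to identify that range with the Krylov space
    ([krylov_three_term]) and to establish the facts about the Lanczos basis:
    orthonormality ([lanczos_Q_orthonormal]) and the relation with the
    tridiagonal matrix ([mul_lanczos_QT]).

    The real and the complex case share one argument, carried out over a field
    with an involutive automorphism [sigma] and the adjoint [B ^t sigma]; taking
    [sigma] to be the identity or the conjugation gives the two cases.  The
    Lanczos quantities are real in both, so their properties are proved once
    over [R] and transported along [R -> R[i]]. *)

(** * Galerkin projection in an energy norm *)

Lemma adjmxM (F : fieldType) (sigma : {rmorphism F -> F}) (m n p : nat)
    (B : 'M[F]_(m, n)) (C : 'M[F]_(n, p)) :
  (B *m C) ^t sigma = C ^t sigma *m B ^t sigma.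
Proof. by rewrite trmx_mul map_mxM. Qed.

Lemma adjmxK (F : fieldType) (sigma : {rmorphism F -> F}) (m n : nat)
    (B : 'M[F]_(m, n)) :
  involutive sigma -> (B ^t sigma) ^t sigma = B.
Proof. by move=> sK; apply/matrixP => i j; rewrite !mxE sK. Qed.

(** A row [c] in the left kernel of the compression gives [x = Q c*] with
    [x* H x = 0], so [Q c* = 0], and [Q] is injective. *)
Lemma compression_unitmx (F : numFieldType) (sigma : {rmorphism F -> F})
    (n k : nat) (H : 'M[F]_n) (Q : 'M[F]_(n, k)) :
  involutive sigma -> Q ^t sigma *m Q = 1%:M ->
  (forall x : 'cV[F]_n, x != 0 -> 0 < (x ^t sigma *m H *m x) 0 0) ->
  Q ^t sigma *m H *m Q \in unitmx.
Proof.
move=> sK QQ Hpos; rewrite -row_free_unit; apply: inj_row_free => v vL0.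
pose x := Q *m v ^t sigma.
have x0 : x = 0.
  apply/eqP/negPn/negP => /Hpos; rewrite /x adjmxM adjmxK // !mulmxA.
  by rewrite -!mulmxA (mulmxA v) !mulmxA in vL0 *; rewrite vL0 mul0mx mxE ltxx.
have vs0 : v ^t sigma = 0 by rewrite -[LHS]mul1mx -QQ -mulmxA -/x x0 mulmx0.
by rewrite -(adjmxK v sK) vs0 trmx0 map_mx0.
Qed.

(** Pythagoras: the cross terms vanish, which leaves the energy of [e] plus the
    nonnegative energy of [Q w]. *)
Lemma energy_le_of_orthogonal (F : numFieldType) (sigma : {rmorphism F -> F})
    (n k : nat) (H : 'M[F]_n) (Q : 'M[F]_(n, k)) (e : 'cV[F]_n) (w : 'cV[F]_k) :
  involutive sigma -> H ^t sigma = H ->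
  (forall x : 'cV[F]_n, x != 0 -> 0 < (x ^t sigma *m H *m x) 0 0) ->
  Q ^t sigma *m H *m e = 0 ->
  (e ^t sigma *m H *m e) 0 0
    <= ((e + Q *m w) ^t sigma *m H *m (e + Q *m w)) 0 0.
Proof.
move=> sK Hh Hpos orth.
have: (Q *m w) ^t sigma *m H *m e = 0.
  by rewrite adjmxM -!mulmxA (mulmxA (Q ^t sigma)) orth mulmx0.
move: (Q *m w) => u ue.
have eu : e ^t sigma *m H *m u = 0.
  have: (e ^t sigma *m H *m u) ^t sigma = 0.
    by rewrite !adjmxM adjmxK // Hh mulmxA ue.
  by move/(congr1 (fun B => B ^t sigma)); rewrite adjmxK // trmx0 map_mx0.
have -> : (e + u) ^t sigma = e ^t sigma + u ^t sigma by rewrite linearD map_mxD.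
rewrite !mulmxDl !mulmxDr ue eu !(add0r, addr0) [leRHS]mxE lerDl.
have [->|/Hpos/ltW //] := eqVneq u 0; by rewrite mulmx0 mxE.
Qed.

(** * The Lanczos-OR iterate as a Galerkin projection *)

Lemma horner_mx_intertwine (F : fieldType) (m n : nat) (A : 'M[F]_n.+1)
    (T : 'M[F]_m.+1) (Q : 'M[F]_(n.+1, m.+1)) (p : {poly F}) :
  A *m Q = Q *m T -> horner_mx A p *m Q = Q *m horner_mx T p.
Proof.
move=> AQ; elim/poly_ind: p => [|p c IH]; first by rewrite !rmorph0 mul0mx mulmx0.
rewrite !rmorphD !rmorphM /= !horner_mx_X !horner_mx_C -!mulmxE.
by rewrite mulmxDl mulmxDr -mulmxA AQ !mulmxA IH scalar_mxC.
Qed.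

(** This is where the leading block of the full [p(T)] matters: in general
    it differs from [p] evaluated at the leading block of [T]. *)
Lemma compression_horner_mx (F : fieldType) (sigma : {rmorphism F -> F})
    (n K k : nat) (hkK : (k <= K.+1)%N) (A : 'M[F]_n.+1) (T : 'M[F]_K.+1)
    (Q : 'M[F]_(n.+1, K.+1)) (p : {poly F}) :
  Q ^t sigma *m Q = 1%:M -> A *m Q = Q *m T ->
  let Qk := colsub (widen_ord hkK) Q in
  leading hkK (horner_mx T p) = Qk ^t sigma *m horner_mx A p *m Qk.
Proof.
move=> QQ AQ /=; rewrite trmx_mxsub map_mxsub -mulmxA mulmx_colsub.
by rewrite (horner_mx_intertwine p AQ) -mxsub_mul mulmxA QQ mul1mx.
Qed.

(** The iterate is [Q L^-1 Q* H y] with [L = Q* H Q], that is, the [H]-orthogonal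
    projection of [y = r(A) b] on the range of the first [k] columns. *)
Lemma lan_OR_minimizes (F : numFieldType) (sigma : {rmorphism F -> F})
    (n K k : nat) (hkK : (k <= K.+1)%N) (A : 'M[F]_n.+1) (b : 'cV[F]_n.+1)
    (T : 'M[F]_K.+1) (Q : 'M[F]_(n.+1, K.+1)) (M N P : {poly F}) :
  involutive sigma -> Q ^t sigma *m Q = 1%:M -> A *m Q = Q *m T ->
  col 0 Q = b -> (0 < k)%N ->
  let H := horner_mx A N *m horner_mx A P in
  H ^t sigma = H ->
  (forall x : 'cV[F]_n.+1, x != 0 -> 0 < (x ^t sigma *m H *m x) 0 0) ->
  let Qk := colsub (widen_ord hkK) Q in
  let y := ratmx M N A *m b in
  let x := lan_OR hkK Qk T M N P in
  [/\ leading hkK (horner_mx T (N * P)) \in unitmx,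
      exists w, x = Qk *m w
    & forall w, ((y - x) ^t sigma *m H *m (y - x)) 0 0
        <= ((y - Qk *m w) ^t sigma *m H *m (y - Qk *m w)) 0 0].
Proof.
move=> sK QQ AQ Q0 k0 H Hh Hpos Qk y x.
have HE : horner_mx A (N * P) = H by rewrite rmorphM -mulmxE.
have QkQk : Qk ^t sigma *m Qk = 1%:M.
  rewrite trmx_mxsub map_mxsub -mxsub_mul QQ; apply/matrixP => i j.
  by rewrite !mxE.
have LE := compression_horner_mx hkK (N * P) QQ AQ; rewrite HE in LE.
have Lu : leading hkK (horner_mx T (N * P)) \in unitmx.
  by rewrite LE; apply: compression_unitmx.
have Hu : H \in unitmx.
  rewrite -[H]mulmx1 -[H]mul1mx.
  have := @compression_unitmx F sigma _ _ H 1%:M sK.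
  by rewrite trmx1 map_mx1; apply=> //; rewrite mulmx1.
(* [N(A)] is a factor of the invertible [H], so [r(A)] is a true quotient. *)
have Nu : horner_mx A N \in unitmx.
  by move: Hu; rewrite unitmx_mul => /andP[].
pose e0 : 'cV[F]_k := \col_(i < k) (i == 0 :> nat)%:R.
have Qe0 : Qk *m e0 = b.
  apply/matrixP => i j; rewrite ord1 -Q0 !mxE (bigD1 (Ordinal k0)) //= !mxE /=.
  rewrite mulr1 big1 => [|l lne]; first by rewrite addr0; congr (Q i _); exact/val_inj.
  rewrite !mxE; case: eqP => [l0|_]; last by rewrite mulr0.
  by case/eqP: lne; apply: val_inj.
(* [H] cancels the denominator of [r(A)]. *)
have Hy : H *m y = horner_mx A (M * P) *m b.
  have cAP : horner_mx A P *m horner_mx A M = horner_mx A M *m horner_mx A P.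
    by rewrite !mulmxE -!rmorphM mulrC.
  have cAN : horner_mx A N *m (horner_mx A M *m horner_mx A P)
             = (horner_mx A M *m horner_mx A P) *m horner_mx A N.
    by rewrite !mulmxE -!rmorphM mulrC.
  rewrite /y /ratmx /H rmorphM -mulmxE !mulmxA -(mulmxA (horner_mx A N)) cAP.
  by rewrite cAN -(mulmxA _ (horner_mx A N)) mulmxV // mulmx1.
set L := leading _ _ in LE Lu.
have xE : x = Qk *m (invmx L *m (Qk ^t sigma *m (H *m y))).
  rewrite Hy -Qe0 /x /lan_OR (compression_horner_mx hkK (M * P) QQ AQ).
  by rewrite -!mulmxA.
rewrite /= -/Qk in LE; clearbody x H Qk.
have orth : Qk ^t sigma *m H *m (y - x) = 0.
  by rewrite mulmxBr xE !mulmxA -LE mulmxV // mul1mx subrr.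
split=> // [|w]; first by exists (invmx L *m (Qk ^t sigma *m (H *m y))).
set v := invmx L *m _ in xE.
have -> : y - Qk *m w = y - x + Qk *m (v - w).
  by rewrite mulmxBr -xE addrA subrK.
exact: energy_le_of_orthogonal.
Qed.

(** * Krylov spaces and three-term recurrences *)

Lemma mulmx_span_sub (F : fieldType) (m n : nat) (A : 'M[F]_(m, n))
    (X : seq 'cV[F]_n) (U : {vspace 'cV[F]_m}) (v : 'cV[F]_n) :
  (forall x, x \in X -> A *m x \in U) -> v \in <<X>>%VS -> A *m v \in U.
Proof.
pose f := linfun (mulmx A : 'cV[F]_n -> 'cV[F]_m) => AX vX.
have: v \in (f @^-1: U)%VS.
  apply: subvP vX; apply/span_subvP => x xX.
  by rewrite -memv_preim lfunE; apply: AX.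
by rewrite -memv_preim lfunE.
Qed.

Lemma span_columnsP (F : fieldType) (n k : nat) (q : nat -> 'cV[F]_n)
    (z : 'cV[F]_n) :
  z \in <<mkseq q k>>%VS <->
  exists w, z = (\matrix_(i < n, j < k) q j i 0) *m w.
Proof.
set Q := \matrix_(i, j) _.
have Qcol (j : 'I_k) : Q *m delta_mx j 0 = q j.
  by rewrite -colE; apply/matrixP => i l; rewrite !mxE ord1.
split=> [zq | [w ->]].
  pose f := linfun (mulmx Q : 'cV[F]_k -> 'cV[F]_n).
  have: z \in limg f.
    apply: subvP zq; apply/span_subvP => x /mapP[j]; rewrite mem_iota /= => jk ->.
    by rewrite -[j]/(val (Ordinal jk)) -Qcol -[_ *m _]lfunE memv_img ?memvf.
  by case/memv_imgP => w _ ->; exists w; rewrite lfunE.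
rewrite (matrix_sum_delta w) mulmx_sumr; apply: memv_suml => i _.
rewrite big_ord1 -scalemxAr Qcol memvZ // memv_span //; apply: map_f.
by rewrite mem_iota /=.
Qed.

Definition three_term (F : fieldType) (n : nat) (A : 'M[F]_n)
    (q : nat -> 'cV[F]_n) (alpha beta : nat -> F) : Prop :=
  forall j, A *m q j =
    (if j is i.+1 then beta i *: q i else 0) + alpha j *: q j
    + beta j *: q j.+1.

Lemma mem_span_mkseq (F : fieldType) (V : vectType F) (u : nat -> V)
    (i m : nat) :
  (i < m)%N -> u i \in <<mkseq u m>>%VS.
Proof. by move=> im; apply/memv_span/map_f; rewrite mem_iota. Qed.

Lemma span_mkseqS (F : fieldType) (V : vectType F) (u : nat -> V)
    (m m' : nat) (v : V) :
  (m <= m')%N -> v \in <<mkseq u m>>%VS -> v \in <<mkseq u m'>>%VS.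
Proof.
move=> /subnKC <-; rewrite /mkseq iotaD map_cat span_cat.
exact/subvP/addvSl.
Qed.

(** Multiplication by [A] raises the index of either family of spans by one.
    Hence the powers [A^i b] lie in the span of the [q_j]; conversely, the
    recurrence can be solved for [q_(j+1)] since [beta_j] is nonzero. *)
Lemma krylov_three_term (F : fieldType) (n : nat) (A : 'M[F]_n)
    (b : 'cV[F]_n) (q : nat -> 'cV[F]_n) (alpha beta : nat -> F) (k : nat) :
  three_term A q alpha beta -> q 0 = b ->
  (forall j, (j.+1 < k)%N -> beta j != 0) ->
  krylov A b k = <<mkseq q k>>%VS.
Proof.
move=> rec q0 beta0.
have powS i : A ^+ i.+1 *m b = A *m (A ^+ i *m b) by rewrite exprS mulmxA.
have qV := mem_span_mkseq q.
have KV i m : (i < m)%N -> A ^+ i *m b \in krylov A b m.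
  exact: (mem_span_mkseq (fun i => A ^+ i *m b)).
have AV m v : v \in <<mkseq q m>>%VS -> A *m v \in <<mkseq q m.+1>>%VS.
  apply: mulmx_span_sub => x /mapP[j]; rewrite mem_iota /= => jm ->.
  rewrite rec !memvD ?memvZ ?qV //; last exact: leqW.
  case: j jm => [|j] jm; first exact: mem0v.
  by rewrite memvZ // qV // leqW // ltnW.
have AK m v : v \in krylov A b m -> A *m v \in krylov A b m.+1.
  apply: mulmx_span_sub => x /mapP[j]; rewrite mem_iota /= => jm ->.
  by rewrite -powS KV.
apply/eqP; rewrite eqEsubv; apply/andP; split; apply/span_subvP => x /mapP[j].
  rewrite mem_iota add0n => /andP[_ jk] ->.
  apply: (span_mkseqS jk).
  elim: j {jk} => [|j IH]; first by rewrite expr0 mul1mx -q0 qV.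
  by rewrite powS AV.
rewrite mem_iota add0n => /andP[_ jk] ->.
have KS m m' v : (m <= m')%N -> v \in krylov A b m -> v \in krylov A b m'.
  exact: (@span_mkseqS _ _ (fun i => A ^+ i *m b)).
apply: (KS _ _ _ jk).
elim/ltn_ind: j jk => -[|j] IH jk.
  by rewrite q0; have := KV 0 1 isT; rewrite expr0 mul1mx.
have bq : beta j *: q j.+1 \in krylov A b j.+2.
  have -> : beta j *: q j.+1 = A *m q j -
      ((if j is i.+1 then beta i *: q i else 0) + alpha j *: q j).
    by rewrite rec addrC addKr.
  have IHj i : (i <= j)%N -> q i \in krylov A b i.+1.
    by move=> ij; apply: IH => //; apply: leq_ltn_trans ij _; apply: ltnW.
  rewrite memvB ?AK ?IHj // memvD //; last first.
    exact/memvZ/(KS _ _ _ (leqnSn _))/IHj.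
  case: j {IH jk} IHj => [|j] IHj; first exact: mem0v.
  exact/memvZ/(KS _ _ _ (leqW (leqnSn _)))/IHj.
have := memvZ (beta j)^-1 bq.
by rewrite scalerA mulVf ?scale1r // beta0.
Qed.

(** * The Lanczos basis *)

Lemma norm2_sqr (R : rcfType) (n : nat) (v : 'cV[R]_n) :
  norm2 v ^+ 2 = (v^T *m v) 0 0.
Proof.
rewrite sqr_sqrtr // mxE sumr_ge0 // => i _.
by rewrite mxE -expr2 sqr_ge0.
Qed.

Lemma norm2_eq0 (R : rcfType) (n : nat) (v : 'cV[R]_n) : norm2 v = 0 -> v = 0.
Proof.
move/(congr1 (fun x => x ^+ 2)); rewrite norm2_sqr expr0n /= mxE => /eqP.
rewrite psumr_eq0 => [/allP v0 | i _]; last by rewrite mxE -expr2 sqr_ge0.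
apply/matrixP => i j; rewrite ord1 [RHS]mxE; apply/eqP.
by have := v0 i (mem_index_enum _); rewrite mxE -expr2 sqrf_eq0.
Qed.

Definition lanczos_residual (R : rcfType) (n : nat) (A : 'M[R]_n)
    (b : 'cV[R]_n) (j : nat) : 'cV[R]_n :=
  A *m lanczos_q A b j
  - (if j is i.+1 then lanczos_beta A b i *: lanczos_q A b i else 0)
  - lanczos_alpha A b j *: lanczos_q A b j.

Lemma lanczos_stepE (R : rcfType) (n : nat) (A : 'M[R]_n) (b : 'cV[R]_n)
    (j : nat) :
  let w := lanczos_residual A b j in
  lanczos_beta A b j = norm2 w /\
  lanczos_q A b j.+1 = (lanczos_beta A b j)^-1 *: w.
Proof.
rewrite /lanczos_residual /lanczos_alpha /lanczos_q /lanczos_beta /=.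
case: j => [|j] /=; first by rewrite scale0r.
by case: lanczos_state => [[q' b'] q].
Qed.

(** The recurrence holds even at a breakdown: [beta_j = 0] means that the
    residual vanishes, so that it still equals [beta_j q_(j+1)]. *)
Lemma lanczos_three_term (R : rcfType) (n : nat) (A : 'M[R]_n) (b : 'cV[R]_n) :
  three_term A (lanczos_q A b) (lanczos_alpha A b) (lanczos_beta A b).
Proof.
move=> j; have [bE qE] := lanczos_stepE A b j.
have -> : lanczos_beta A b j *: lanczos_q A b j.+1 = lanczos_residual A b j.
  rewrite qE scalerA; have [b0|b0] := eqVneq (lanczos_beta A b j) 0.
    by rewrite b0 mul0r scale0r (@norm2_eq0 _ _ (lanczos_residual A b j)) // -bE.
  by rewrite divff // scale1r.
by rewrite /lanczos_residual -[_ - _ - _]addrA -opprD [RHS]addrC subrK.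
Qed.

(** Induction on the number of vectors.  By symmetry of [A],
    [<q_l, A q_m> = <q_m, A q_l>], and expanding [A q_l] by the recurrence shows
    that for [l < m] this is nonzero only if [l = m - 1], where it is
    [beta_(m-1)]: the term subtracted by the algorithm. *)
Lemma lanczos_orthonormal (R : rcfType) (n : nat) (A : 'M[R]_n) (b : 'cV[R]_n)
    (K : nat) :
  A^T = A -> norm2 b = 1 ->
  (forall j, (j.+1 < K)%N -> lanczos_beta A b j != 0) ->
  forall i j, (i < K)%N -> (j < K)%N ->
  ((lanczos_q A b i)^T *m lanczos_q A b j) 0 0 = (i == j)%:R.
Proof.
move=> AT b1 beta0; set q := lanczos_q A b.
set beta := lanczos_beta A b in beta0 *; set alpha := lanczos_alpha A b.
pose dot (u v : 'cV[R]_n) := (u^T *m v) 0 0.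
have dotC u v : dot u v = dot v u by rewrite /dot -[in LHS](trmxK v) -trmx_mul mxE.
have dotDr u v w : dot u (v + w) = dot u v + dot u w.
  by rewrite /dot mulmxDr mxE.
have dotZr u c v : dot u (c *: v) = c * dot u v.
  by rewrite /dot -scalemxAr mxE.
have dot0r u : dot u 0 = 0 by rewrite /dot mulmx0 mxE.
have dotA u v : dot u (A *m v) = dot v (A *m u).
  by rewrite dotC /dot trmx_mul AT mulmxA.
suff main m : (m < K)%N -> forall i j, (i <= m)%N -> (j <= m)%N ->
    dot (q i) (q j) = (i == j)%:R.
  move=> i j iK jK; case: (leqP i j) => [ij|/ltnW ji].
    exact: (main j).
  exact: (main i).
elim: m => [|m IH] mK i j.
  rewrite !leqn0 => /eqP-> /eqP->.
  by rewrite /dot -norm2_sqr b1 expr1n.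
have {}IH := IH (ltnW mK).
have rec l : A *m q l = (if l is i.+1 then beta i *: q i else 0)
    + alpha l *: q l + beta l *: q l.+1 := lanczos_three_term A b l.
have bm := beta0 m mK.
have new l : (l <= m)%N -> dot (q l) (q m.+1) = 0.
  move=> lm; apply: (mulfI bm); rewrite mulr0 -dotZr.
  have -> : beta m *: q m.+1 = A *m q m
      + - 1 *: ((if m is i.+1 then beta i *: q i else 0) + alpha m *: q m).
    by rewrite rec scaleN1r addrC addKr.
  rewrite dotDr dotZr mulN1r dotDr.
  have dprev p u : dot u (if p is i.+1 then beta i *: q i else 0)
      = if p is i.+1 then beta i * dot u (q i) else 0.
    by case: p => [|p]; rewrite ?dot0r ?dotZr.
  rewrite dprev dotZr; case: (ltngtP l m) lm => // [lm|->] _.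
    rewrite dotA rec !dotDr dprev !dotZr !IH // ?(ltnW lm) //.
    rewrite (gtn_eqF lm) (ltn_eqF lm) !mulr0 !addr0.
    have -> : (if l is i.+1 then beta i * dot (q m) (q i) else 0) = 0.
      case: l lm => [//|l] lm; rewrite IH ?mulr0 //; last by do 2!apply: ltnW.
      by rewrite gtn_eqF ?mulr0 // ltnW.
    rewrite add0r; case: m lm {mK bm} IH => [//|m] lm IH.
    rewrite IH //; last exact: ltnW.
    rewrite eqSS eq_sym; have [->|_] := eqVneq l m; first by rewrite subrr.
    by rewrite !mulr0 subrr.
  have -> : dot (q m) (A *m q m) = alpha m by rewrite /dot mulmxA.
  rewrite IH // eqxx mulr1; case: m {mK bm} IH => [|m] IH; first by rewrite add0r subrr.
  by rewrite IH // gtn_eqF // mulr0 add0r subrr.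
have norm1 : dot (q m.+1) (q m.+1) = 1.
  have [bE qE] := lanczos_stepE A b m; rewrite -/q -/beta in qE bE.
  rewrite qE dotZr dotC dotZr /dot -norm2_sqr -bE expr2.
  by rewrite mulKf // mulVf.
rewrite leq_eqVlt => /orP[/eqP->|im]; rewrite leq_eqVlt => /orP[/eqP->|jm].
- by rewrite norm1 eqxx.
- by rewrite dotC new // gtn_eqF.
- by rewrite new // ltn_eqF.
- exact: IH.
Qed.

Lemma lanczos_Q_orthonormal (R : rcfType) (n : nat) (A : 'M[R]_n)
    (b : 'cV[R]_n) (K : nat) :
  A^T = A -> norm2 b = 1 ->
  (forall j, (j.+1 < K)%N -> lanczos_beta A b j != 0) ->
  (lanczos_Q A b K)^T *m lanczos_Q A b K = 1%:M.
Proof.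
move=> AT b1 beta0; apply/matrixP => i j; rewrite [RHS]mxE.
rewrite -(lanczos_orthonormal AT b1 beta0 (ltn_ord i) (ltn_ord j)) !mxE.
by apply: eq_bigr => l _; rewrite !mxE.
Qed.

(** Column by column this is the recurrence; in the last column the vector
    [q_(K+1)], which the basis does not contain, has coefficient
    [beta_K = 0]. *)
Lemma mul_lanczos_QT (R : rcfType) (n : nat) (A : 'M[R]_n) (b : 'cV[R]_n)
    (K : nat) :
  lanczos_beta A b K = 0 ->
  A *m lanczos_Q A b K.+1 = lanczos_Q A b K.+1 *m lanczos_T A b K.+1.
Proof.
move=> betaK; set q := lanczos_q A b; set beta := lanczos_beta A b.
set alpha := lanczos_alpha A b.
have colQ m (j : 'I_m) : col j (lanczos_Q A b m) = q j.
  by apply/matrixP => i l; rewrite !mxE ord1.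
apply/matrixP => i j.
transitivity ((A *m q j) i 0).
  by rewrite -colQ colE mulmxA -colE [RHS]mxE.
rewrite lanczos_three_term -/q -/beta -/alpha.
have TE (l : 'I_K.+1) : lanczos_T A b K.+1 l j =
    (if l.+1 == j :> nat then beta l else 0)
    + (if l == j :> nat then alpha j else 0)
    + (if l == j.+1 :> nat then beta j else 0).
  rewrite mxE -/alpha -/beta [_ == l :> nat]eq_sym; case: (ltngtP l j) => [lj|jl|->].
  - by rewrite [l == j.+1 :> nat]ltn_eqF ?(leqW lj) // !addr0.
  - by rewrite gtn_eqF ?(leqW jl) // !add0r.
  - by rewrite gtn_eqF // ltn_eqF // add0r addr0.
have pick m c : \sum_(l < K.+1) lanczos_Q A b K.+1 i l *
    (if l == m :> nat then c else 0) = if (m < K.+1)%N then c * q m i 0 else 0.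
  under eq_bigr => l _ do rewrite mxE -/q mulrC.
  transitivity (\sum_(l < K.+1 | l == m :> nat) c * q l i 0).
    rewrite [RHS]big_mkcond; apply: eq_bigr => l _.
    by case: ifP; rewrite ?mul0r.
  exact: (big_ord1_eq _ (fun l => c * q l i 0)).
rewrite [RHS]mxE; under [RHS]eq_bigr => l _ do rewrite TE !mulrDr.
rewrite !big_split /= !pick ltn_ord !mxE; congr (_ + _ + _).
  case: j {TE} => -[|j] jK /=.
    by rewrite mxE big1 // => l _; rewrite mulr0.
  under eq_bigr => l _.
    rewrite eqSS (_ : (if _ then _ else _) = if l == j :> nat then beta j else 0).
      over.
    by case: eqP => // ->.
  by rewrite pick (ltnW jK) mxE.
case: ifP => // /negbT; rewrite ltnS -leqNgt => Kj.
have jK : j = K :> nat by apply/eqP; rewrite eqn_leq Kj andbT -ltnS ltn_ord.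
by rewrite jK /beta betaK mul0r.
Qed.

(** * Optimality over the Krylov space *)

Lemma lan_OR_krylov_minimizes (F : numFieldType) (sigma : {rmorphism F -> F})
    (n K k : nat) (hkK : (k <= K.+1)%N) (A : 'M[F]_n.+1) (b : 'cV[F]_n.+1)
    (q : nat -> 'cV[F]_n.+1) (alpha beta : nat -> F) (T : 'M[F]_K.+1)
    (M N P : {poly F}) :
  involutive sigma -> three_term A q alpha beta -> q 0 = b ->
  (forall j, (j < K)%N -> beta j != 0) ->
  let Q m : 'M_(n.+1, m) := \matrix_(i < n.+1, j < m) q j i 0 in
  (Q K.+1) ^t sigma *m Q K.+1 = 1%:M -> A *m Q K.+1 = Q K.+1 *m T ->
  (0 < k)%N ->
  let H := horner_mx A N *m horner_mx A P in
  H ^t sigma = H ->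
  (forall x : 'cV[F]_n.+1, x != 0 -> 0 < (x ^t sigma *m H *m x) 0 0) ->
  let y := ratmx M N A *m b in
  let x := lan_OR hkK (Q k) T M N P in
  [/\ leading hkK (horner_mx T (N * P)) \in unitmx, x \in krylov A b k
    & forall z, z \in krylov A b k ->
      ((y - x) ^t sigma *m H *m (y - x)) 0 0
        <= ((y - z) ^t sigma *m H *m (y - z)) 0 0].
Proof.
move=> sK rec q0 beta0 Q QQ AQ k0 H Hh Hpos y x.
have QkE : colsub (widen_ord hkK) (Q K.+1) = Q k.
  by apply/matrixP => i j; rewrite !mxE.
have colQ0 : col 0 (Q K.+1) = b.
  by rewrite -q0; apply/matrixP => i j; rewrite !mxE ord1.
have [Lu xQ xmin] := lan_OR_minimizes hkK M sK QQ AQ colQ0 k0 Hh Hpos.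
rewrite QkE -/x -/y in xQ xmin.
have krylovP := krylov_three_term rec q0 (fun j jk => beta0 j (leq_trans jk hkK)).
by rewrite krylovP; split=> // [|z /span_columnsP[w ->]]; first exact/span_columnsP.
Qed.

Theorem theorem2p2 (R : rcfType) (n : nat) (A : 'M[R]_n.+1) (b : 'cV[R]_n.+1)
    (K k : nat) (hkK : (k <= K.+1)%N) :
  A^T = A -> norm2 b = 1 ->
  (1 <= k)%N -> lanczos_terminates A b K.+1 ->
  (* real coefficients, span over R *)
  (forall M N P : {poly R},
     N \is monic ->
     (forall a : R, eigenvalue A a -> N.[a] != 0) ->
     coprimep M N ->
     let H := horner_mx A N *m horner_mx A P in
     posdef H ->
     leading hkK (horner_mx (lanczos_T A b K.+1) (N * P)) \in unitmx /\
     best_approx (mxnorm_of H) (krylov A b k)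
       (ratmx M N A *m b)
       (lan_OR hkK (lanczos_Q A b k) (lanczos_T A b K.+1) M N P)) /\
  (* complex coefficients, span over R[i] *)
  (forall M N P : {poly R[i]},
     N \is monic ->
     (forall a : R[i], eigenvalue (toC A) a -> N.[a] != 0) ->
     coprimep M N ->
     let H := horner_mx (toC A) N *m horner_mx (toC A) P in
     posdefC H ->
     leading hkK (horner_mx (toC (lanczos_T A b K.+1)) (N * P)) \in unitmx /\
     best_approx (mxnorm_ofC H) (krylov (toC A) (toC b) k)
       (ratmx M N (toC A) *m toC b)
       (lan_OR hkK (toC (lanczos_Q A b k)) (toC (lanczos_T A b K.+1)) M N P)).
Proof.
move=> AT b1 k1 [_ betaK beta0].
have rec := lanczos_three_term A b.
have QQ := lanczos_Q_orthonormal AT b1 beta0.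
have AQ := mul_lanczos_QT betaK.
split=> M N P _ _ _ H [Hh Hpos].
  have idE m p (B : 'M[R]_(m, p)) : B ^t idfun = B^T.
    by apply/matrixP => i j; rewrite !mxE.
  have [] := @lan_OR_krylov_minimizes R idfun _ _ _ hkK A b (lanczos_q A b)
    _ _ (lanczos_T A b K.+1) M N P (fun=> erefl) rec erefl beta0 _ AQ k1.
  - by rewrite idE.
  - by rewrite idE.
  - by move=> x /Hpos; rewrite idE.
  move=> Lu xK xmin; split=> //; split=> // z /xmin.
  by rewrite !idE; apply: ler_wsqrtr.
have toCQ m : toC (lanczos_Q A b m)
    = \matrix_(i < n.+1, j < m) toC (lanczos_q A b j) i 0.
  by apply/matrixP => i j; rewrite !mxE.
pose rc := real_complex R.
have recC : three_term (toC A) (fun j => toC (lanczos_q A b j))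
    (rc \o lanczos_alpha A b) (rc \o lanczos_beta A b).
  move=> j; rewrite -map_mxM rec !map_mxD !map_mxZ; congr (_ + _ + _).
  by case: j => [|j]; rewrite ?map_mx0 ?map_mxZ.
have betaC j : (j < K)%N -> (rc \o lanczos_beta A b) j != 0.
  by move=> jK; rewrite /= fmorph_eq0 beta0.
have AQC := congr1 (@toC R _ _) AQ.
rewrite /toC !map_mxM -/(toC _) -!/(toC _) toCQ in AQC.
have QQC : (toC (lanczos_Q A b K.+1)) ^t* *m toC (lanczos_Q A b K.+1) = 1%:M.
  have -> : (toC (lanczos_Q A b K.+1)) ^t* = toC (lanczos_Q A b K.+1)^T.
    by apply/matrixP => i j; rewrite !mxE; apply: conjc_real.
  by rewrite -map_mxM QQ map_mx1.
rewrite toCQ in QQC.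
(* Comparing complex square roots requires nonnegative arguments. *)
have form_ge0 (x : 'cV[R[i]]_n.+1) : 0 <= (x ^t* *m H *m x) 0 0.
  by have [->|/Hpos/ltW //] := eqVneq x 0; rewrite mulmx0 mxE.
have [] := @lan_OR_krylov_minimizes R[i] Num.conj _ _ _ hkK (toC A) (toC b)
  (fun j => toC (lanczos_q A b j)) _ _ (toC (lanczos_T A b K.+1)) M N P
  (@conjCK _) recC erefl betaC QQC AQC k1 Hh Hpos.
rewrite -toCQ => Lu xK xmin; split=> //; split=> // z /xmin.
by rewrite /mxnorm_ofC ler_sqrtC ?nnegrE.
Qed.
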